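(* Let $m\geq1$ and $k\geq2$ be integers and let $G$ be an $m$-connected graph of order $n\geq\max\{(7k-2)m+4,\ (k-1)m^2+\frac12(3k+1)m+\frac92\}$. If $\rho(G)\geq\rho(K_m\vee(K_{n-km-1}+I_{km-m+1}))$, then $G$ has a spanning $k$-tree unless $G\cong K_m\vee(K_{n-km-1}+I_{km-m+1})$.
   Context: All graphs are finite and simple. $\rho(G)$ is the spectral radius of the adjacency matrix of $G$. A spanning $k$-tree of a connected graph is a spanning tree in which every vertex has degree at most $k$. $K_n$ is the complete graph and $I_n$ the edgeless graph on $n$ vertices; $G_1+G_2$ denotes disjoint union and $G_1\vee G_2$ the join. *)

(* Defs.v *)
From HB Require Import structures.
From mathcomp Require Import all_boot all_order all_algebra all_fingroup all_field.
Set Implicit Arguments. Unset Strict Implicit. Unset Printing Implicit Defensive.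
Import Order.TTheory GRing.Theory Num.Theory.
Local Open Scope ring_scope.

Definition simple_graph (n : nat) (G : rel 'I_n) : Prop :=
  symmetric G /\ irreflexive G.

Definition adjmx (n : nat) (G : rel 'I_n) : 'M[algC]_n :=
  \matrix_(i, j) ((G i j : nat)%:R).

Definition spectral_radius (n : nat) (A : 'M[algC]_n) (r : algC) : Prop :=
  (exists2 l, eigenvalue A l & `|l| = r) /\
  (forall l, eigenvalue A l -> `|l| <= r).

Definition gconnected (n : nat) (G : rel 'I_n) : Prop :=
  forall x y : 'I_n, connect G x y.

Definition connected_minus (n : nat) (G : rel 'I_n) (S : {set 'I_n}) : Prop :=
  forall x y : 'I_n, x \notin S -> y \notin S ->
    connect [rel u v | [&& G u v, u \notin S & v \notin S]] x y.

Definition m_connected (n m : nat) (G : rel 'I_n) : Prop :=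
  (m < n)%N /\ forall S : {set 'I_n}, (#|S| < m)%N -> connected_minus G S.

Definition acyclic (n : nat) (T : rel 'I_n) : Prop :=
  ~ exists c : seq 'I_n, [/\ (2 < size c)%N, uniq c & path.cycle T c].

Definition degree (n : nat) (T : rel 'I_n) (x : 'I_n) : nat := #|[set y | T x y]|.

Definition spanning_k_tree (n k : nat) (G T : rel 'I_n) : Prop :=
  [/\ simple_graph T, subrel T G, gconnected T, acyclic T &
      forall x, (degree T x <= k)%N].

Definition has_spanning_k_tree (n k : nat) (G : rel 'I_n) : Prop :=
  exists T : rel 'I_n, spanning_k_tree k G T.

Definition graph_iso (n : nat) (G H : rel 'I_n) : Prop :=
  exists f : {perm 'I_n}, forall x y, G x y = H (f x) (f y).

(* K_m \/ (K_{n-km-1} + I_{km-m+1}) on 'I_n: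
   vertices 0..m-1 form K_m (joined to everything),
   vertices m..m+(n-km-1)-1 form the clique K_{n-km-1},
   the remaining km-m+1 vertices form the independent set. *)
Definition extremal_graph (n m k : nat) : rel 'I_n :=
  fun i j => (i != j) &&
    [|| (i < m)%N, (j < m)%N |
        ((i < m + (n - k * m - 1))%N && (j < m + (n - k * m - 1))%N)].
Arguments extremal_graph : clear implicits.

(* Main.v *)
(** Let s = (k-1)m + 2.  If u, v are nonadjacent with d(u) + d(v) >= n - 1 - (k-2)m
    in an m-connected graph G, then G has a spanning k-tree as soon as G + uv has
    one: delete uv from such a tree, and root the two halves at u and v.  A vertex
    can receive one more tree edge if it has fewer than k - 1 children, or if one
    of its children can be moved to the root; if no edge of G joins the two halves
    at such vertices, the remaining (saturated) vertices separate u from v, so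
    there are at least m of them, and their children are not neighbours of the
    root, which makes d(u) + d(v) too small.

    The bound rho^2 <= 2e - n + 1 and rho(H) >= n - s for the extremal graph H make
    G dense.  Closing G under the above step leaves, by counting nonadjacent pairs,
    either a complete graph or exactly H; hence G has a spanning k-tree or embeds
    in H.  In the latter case the entrywise absolute value of a leading eigenvector
    of G is a maximiser of the Rayleigh quotient of H, so it is a positive
    eigenvector of H, and no edge of H can be missing from G. *)

Require Import Defs.
From HB Require Import structures.
From mathcomp Require Import all_boot all_order all_algebra all_fingroup all_field.
From mathcomp Require Import spectral sesquilinear zify.
Import Order.TTheory GRing.Theory Num.Theory.
Set Implicit Arguments.
Unset Strict Implicit.
Unset Printing Implicit Defensive.

(** * Parent functions and spanning trees *)

(* Acyclicity is not required: a spanning tree is extracted by [parent_function]. *)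
Definition conn_bounded (n k : nat) (G : rel 'I_n) : Prop :=
  exists T : rel 'I_n, [/\ symmetric T, subrel T G, gconnected T &
    forall x, degree T x <= k].

Definition add_edge (n : nat) (G : rel 'I_n) (u v : 'I_n) : rel 'I_n :=
  fun a b => [|| G a b, (a == u) && (b == v) | (a == v) && (b == u)].

Lemma connect_cross (V : finType) (e : rel V) (P : pred V) (a b : V) :
  connect e a b -> P a -> ~~ P b -> exists x y, [/\ e x y, P x & ~~ P y].
Proof.
case/connectP=> p; elim: p a => [|c p IH] a /=; first by move=> _ -> ->.
case/andP=> eac ecp eb Pa Pb; have [Pc|nPc] := boolP (P c); first exact: IH eb Pc Pb.
by exists a, c.
Qed.

(** Here [d] is the distance to [R] along [e], and [f] picks a neighbour strictly nearer to [R]: a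
    breadth-first forest rooted at [R]. *)
Lemma parent_function (V : finType) (e : rel V) (R : {set V}) :
  (forall x, exists2 r, r \in R & connect e x r) ->
  exists (f : V -> V) (d : V -> nat), (forall r, r \in R -> f r = r) /\
    (forall x, x \notin R -> e x (f x) /\ d (f x) < d x).
Proof.
move=> reach.
pose D x k := [exists p : k.-tuple V, path e x p && (last x p \in R)].
have exD x : exists k, D x k.
  have [r rR /connectP[p ep rp]] := reach x.
  by exists (size p); apply/existsP; exists (in_tuple p); rewrite ep -rp.
pose d x := ex_minn (exD x).
have step x : x \notin R -> exists y, e x y && (d y < d x).
  rewrite {2}/d; case: ex_minnP => k /existsP[[p /= /eqP sp]] /andP[ep lp] _ xR.
  case: p sp ep lp => [|y p] /= sp; first by rewrite (negbTE xR).
  case/andP=> exy ep lp; exists y; rewrite exy /= -sp ltnS /d.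
  case: ex_minnP => j _; apply; apply/existsP; exists (in_tuple p).
  by rewrite ep.
exists (fun x => if x \in R then x else odflt x [pick y | e x y && (d y < d x)]), d.
split=> [r -> // | x xR]; rewrite (negbTE xR); case: pickP => [y /andP[]//|no].
by have [y] := step x xR; rewrite no.
Qed.

Lemma rank_fconnect (V : finType) (f : V -> V) (d : V -> nat) (R : {set V}) :
  (forall x, x \notin R -> d (f x) < d x) ->
  forall x, exists2 r, r \in R & fconnect f x r.
Proof.
move=> df x; move: {2}(d x).+1 (ltnSn (d x)) => N.
elim: N x => // N IH x; rewrite ltnS => dx.
have [xR|xR] := boolP (x \in R); first by exists x.
have [r rR fr] := IH (f x) (leq_trans (df x xR) dx).
by exists r => //; apply: connect_trans fr; apply: fconnect1.
Qed.

(** The parent edges of a breadth-first tree of [T] rooted at vertex 0 lie in [T], so they inherit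
    its degree bound. Strictly decreasing ranks along parents exclude cycles. *)
Lemma conn_bounded_spanning_k_tree (n k : nat) (G : rel 'I_n) :
  irreflexive G -> 0 < n -> conn_bounded k G -> has_spanning_k_tree k G.
Proof.
case: n G => // n G irrG _ [T [symT TG conT degT]].
have [f [d [fr fd]]] : exists (f : 'I_n.+1 -> 'I_n.+1) (d : 'I_n.+1 -> nat),
    (forall r, r \in [set ord0] -> f r = r) /\
    (forall x, x \notin [set ord0] -> T x (f x) /\ d (f x) < d x).
  by apply: parent_function => x; exists ord0; rewrite ?set11.
set R := [set ord0] in fr fd.
pose F : rel 'I_n.+1 := fun a b =>
  (a \notin R) && (f a == b) || (b \notin R) && (f b == a).
have FT : subrel F T.
  move=> a b /orP[] /andP[/fd[Tab _] /eqP <-] //; by rewrite symT.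
have symF : symmetric F by move=> a b; rewrite /F orbC.
have Fd a b : F a b -> d b <= d a -> b = f a.
  case/orP=> /andP[nR /eqP <-] //; have [_] := fd _ nR.
  by rewrite ltnNge => /negbTE ->.
exists F; split.
- by split=> // a; apply/negP=> /FT/TG; rewrite irrG.
- by move=> a b /FT/TG.
- have con0 x : connect F x ord0.
    have [|r /set1P -> ] := @rank_fconnect _ f d R _ x.
      by move=> y /fd[].
    apply: connect_sub => a b /eqP <-; have [aR|aR] := boolP (a \in R).
      by rewrite fr.
    by apply: connect1; rewrite /F aR eqxx.
  move=> x y; apply: connect_trans (con0 x) _.
  by rewrite (sym_connect_sym symF).
- case=> c [sc uc cc].
  (* a vertex of maximal rank on the cycle would have its parent as both cyclic neighbours *)
  have c0 : exists a, a \in c by case: (c) sc => // a c' _; exists a; rewrite mem_head.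
  have [a0 a0c] := c0.
  have [a ac amax] : exists2 a, a \in c & forall b, b \in c -> d b <= d a.
    case: (@arg_maxnP _ a0 (mem c) d a0c) => a ac amax; by exists a.
  have [i p rp] := rot_to ac.
  move: sc uc cc; rewrite -(size_rot i) -(rot_uniq i) -(rot_cycle i) rp.
  have pmax b : b \in p -> d b <= d a.
    by move=> bp; apply: amax; rewrite -(mem_rot i) rp inE bp orbT.
  case: p pmax {rp} => [|b p] // pmax /= sp /andP[_ /andP[bp _]].
  rewrite rcons_path => /andP[Fab /andP[_ Fza]].
  have lp : last b p \in b :: p by apply: mem_last.
  have bf := Fd _ _ Fab (pmax b (mem_head _ _)).
  have zf : last b p = f a by apply: Fd (pmax _ lp); rewrite symF.
  case: p sp bp {lp pmax Fza} zf => //= y p _ bp zf.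
  by move: bp; rewrite bf -zf mem_last.
- move=> x; apply: leq_trans (degT x); apply: subset_leq_card.
  by apply/subsetP=> y; rewrite !inE => /FT.
Qed.

(** * The closure step *)

Section TwoRootedForest.

Variables (n : nat) (G : rel 'I_n).
Variables (R : {set 'I_n}).

(** A rooted spanning forest encoded as a parent map: roots are fixed points, and the third clause
    excludes any cycle of [f] outside [R]. *)
Definition forest (f : 'I_n -> 'I_n) : Prop :=
  [/\ forall r, r \in R -> f r = r,
      forall x, x \notin R -> G x (f x) &
      forall x, exists2 r, r \in R & fconnect f x r].

Definition children (f : 'I_n -> 'I_n) (w : 'I_n) : {set 'I_n} :=
  [set a | (a \notin R) && (f a == w)].

Lemma forest_root_unique f x r t : forest f -> r \in R -> t \in R ->
  fconnect f x r -> fconnect f x t -> r = t.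
Proof.
move=> Ff rR tR xr xt; have [fR _ _] := Ff.
have fix_ i j y : iter i f y \in R -> i <= j -> iter j f y = iter i f y.
  by move=> iR /subnK <-; elim: (j - i) => //= l ->; apply: fR.
have Er := iter_findex xr; have Et := iter_findex xt.
have [le|/ltnW le] := leqP (findex f x r) (findex f x t).
  by rewrite -Et (fix_ (findex f x r)) ?Er.
by rewrite -Er (fix_ (findex f x t)) ?Et.
Qed.

Definition redirect (f : 'I_n -> 'I_n) (c r : 'I_n) : 'I_n -> 'I_n :=
  fun a => if a == c then r else f a.

Section Redirect.

Variables (f : 'I_n -> 'I_n) (c r : 'I_n).
Hypotheses (Ff : forest f) (cR : c \notin R) (rR : r \in R).
Hypotheses (fcr : fconnect f c r) (Gcr : G c r).

(** Follow the old orbit from [a] to [t]. If it meets [c], then [t = r] because [c] lies in the tree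
    of [r], and the new arc reaches [r] at once. *)
Lemma redirect_fconnect a t : t \in R -> fconnect f a t ->
  fconnect (redirect f c r) a t.
Proof.
move=> tR fat; have := iter_findex fat.
move: (findex f a t) => i; elim: i a fat => [|i IH] a fat; first by move=> <-.
rewrite iterSr => E; apply: connect_trans (fconnect1 _ a) _; rewrite /redirect.
case: eqP fat => [->|ac] fat.
  by rewrite (forest_root_unique Ff rR tR fcr fat).
by apply: IH => //; rewrite -E fconnect_iter.
Qed.

Lemma redirect_forest : forest (redirect f c r).
Proof.
have [fR fG fr] := Ff; split=> x.
- move=> xR; rewrite /redirect; case: eqP => [xc|_]; last exact: fR.
  by move: cR; rewrite -xc xR.
- by move=> xR; rewrite /redirect; case: eqP => [->|_] //; apply: fG.
- by have [t tR xt] := fr x; exists t => //; apply: redirect_fconnect.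
Qed.

Lemma redirect_children w : w != r -> children (redirect f c r) w = children f w :\ c.
Proof.
move=> wr; apply/setP=> a; rewrite !inE /redirect.
by have [->|ac] := eqVneq a c; rewrite //= [r == w]eq_sym (negbTE wr) andbF.
Qed.

Lemma redirect_children_root : children (redirect f c r) r \subset c |: children f r.
Proof.
by apply/subsetP=> a; rewrite !inE /redirect; case: (a == c).
Qed.

End Redirect.

(* Vertices of the tree rooted at [r] that cannot take an extra tree edge, even
   after one of their children is moved to [r]. *)
Definition saturated (k : nat) (f : 'I_n -> 'I_n) (r : 'I_n) : {set 'I_n} :=
  [set x | [&& fconnect f x r, x \notin R, #|children f x| == k.-1 &
            [forall c in children f x, ~~ G c r]]].

(** The sum bounded by [k] counts children, parent edge and the new edge at [x]. If [x] is a root or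
    has fewer than [k - 1] children, [f] itself serves. Otherwise some child of [x] is adjacent to
    [r] and is moved there; [r] has room, having no parent edge and fewer than [k] children. *)
Lemma free_slot k f r x : 1 < k -> forest f -> r \in R ->
  (forall w, fconnect f w r -> #|children f w| < k) ->
  fconnect f x r -> x \notin saturated k f r ->
  exists g, [/\ forest g,
    forall a t, t \in R -> fconnect f a t -> fconnect g a t,
    forall w, fconnect f w r ->
      #|children g w| + (w \notin R) + (w == x) <= k &
    forall w, ~~ fconnect f w r -> children g w = children f w].
Proof.
move=> k1 Ff rR chk xr xS; have [xR|xR] := boolP (x \in R).
  exists f; split=> // w wr; have := chk w wr.
  by have [->|_] := eqVneq w x; rewrite ?xR; case: (w \in R) => /=; lia.
have := xS; rewrite inE xr xR /=; have [chx|chx] /= := eqVneq; last first.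
  move=> _; exists f; split=> // w wr; have := chk w wr.
  by have [->|_] := eqVneq w x; rewrite ?xR; case: (w \in R) => /=; lia.
rewrite negb_forall => /existsP[c]; rewrite negb_imply negbK inE -andbA.
case/and3P=> cR /eqP fcx Gcr.
have fcr : fconnect f c r by apply: connect_trans (fconnect1 f c) _; rewrite fcx.
have cch : c \in children f x by rewrite inE cR fcx eqxx.
have rx : x != r by apply: contraNneq xR => ->.
exists (redirect f c r); split.
- exact: redirect_forest.
- by move=> a t tR; apply: redirect_fconnect.
- move=> w wr; have := chk w wr; have [->|wx] := eqVneq w x.
    rewrite redirect_children // xR; have := cardsD1 c (children f x).
    by rewrite cch /= => -> ; rewrite !addn1.
  have [->|nwr] := eqVneq w r.
    rewrite rR => lek; apply: leq_trans lek; rewrite addn0 /= addn0.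
    apply: leq_trans (subset_leq_card (redirect_children_root f c r)) _.
    by rewrite cardsU1; case: (_ \in _) => /=; lia.
  rewrite redirect_children //.
  move=> lek; rewrite addn0; apply: leq_trans lek; rewrite -addn1.
  by apply: leq_add (leq_b1 _); apply/subset_leq_card/subD1set.
- move=> w wr; rewrite redirect_children.
    apply/setP=> a; rewrite !inE; have [->|//] := eqVneq a c.
    by rewrite fcx; case: eqP wr => [<-|]; rewrite ?xr ?andbF.
  by apply: contraNneq wr => ->; apply: connect0.
Qed.

End TwoRootedForest.

(** The parent edges together with [x y] connect everything, since [x y] links the two trees. The
    degree hypothesis counts children, parent, and the new edge at either end. *)
Lemma forest_join n k (G : rel 'I_n) u v x y f :
  symmetric G -> forest G [set u; v] f ->
  fconnect f x u -> fconnect f y v -> G x y ->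
  (forall w, #|children [set u; v] f w| + (w \notin [set u; v]) + (w == x) + (w == y) <= k) ->
  conn_bounded k G.
Proof.
pose R := [set u; v]; rewrite -/R; have RE : R = [set u; v] by []; clearbody R.
move=> symG [fR fG fr] xu yv Gxy deg.
pose T : rel 'I_n := fun a b => [|| (a \notin R) && (f a == b), (b \notin R) && (f b == a),
  (a == x) && (b == y) | (a == y) && (b == x)].
have symT : symmetric T.
  by move=> a b; rewrite /T orbCA [(b == x) && _]andbC [(b == y) && _]andbC
    [X in _ || (_ || X)]orbC.
have fT a t : fconnect f a t -> connect T a t.
  apply: connect_sub => {}a b /eqP <-; have [aR|aR] := boolP (a \in R).
    by rewrite fR.
  by apply: connect1; rewrite /T aR eqxx.
have Tx a b : connect T a b = connect T b a by apply: sym_connect_sym.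
exists T; split => //.
- move=> a b /or4P[] /andP[]; first by move=> aR /eqP <-; apply: fG.
  + by move=> bR /eqP <-; rewrite symG; apply: fG.
  + by move=> /eqP-> /eqP->.
  + by move=> /eqP-> /eqP->; rewrite symG.
- have uv : connect T u v.
    rewrite Tx; apply: connect_trans (fT _ _ xu); rewrite Tx.
    apply: connect_trans (fT _ _ yv); apply: connect1.
    by rewrite /T !eqxx !orbT.
  have toR a b r t : r \in R -> t \in R -> connect T a r -> connect T b t -> connect T a b.
    move=> rR tR ar bt; apply: connect_trans ar _; rewrite Tx.
    apply: connect_trans bt _; move: rR tR.
    by rewrite RE !inE => /pred2P[] -> /pred2P[] -> //; rewrite Tx.
  move=> a b; have [r rR ar] := fr a; have [t tR bt] := fr b.
  by apply: toR rR tR (fT _ _ ar) (fT _ _ bt).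
- move=> w; apply: leq_trans (deg w).
  (* The neighbours of [w] are covered by its children and three conditional singletons: its parent,
     [y] when [w] is [x], and [x] when [w] is [y]. *)
  pose opt (b : bool) (z : 'I_n) : {set 'I_n} := if b then [set z] else set0.
  have copt b z : #|opt b z| = b by case: b; rewrite ?cards1 ?cards0.
  rewrite -(copt (w \notin R) (f w)) -(copt (w == x) y) -(copt (w == y) x).
  apply: leq_trans (leq_trans (leq_card_setU _ _) (leq_add (leq_trans (leq_card_setU _ _)
    (leq_add (leq_card_setU _ _) (leqnn _))) (leqnn _))).
  apply: subset_leq_card; apply/subsetP=> b; rewrite in_set !in_setU.
  case/or4P=> /andP[Hw /eqP Hb].
  - by rewrite /opt Hw Hb set11 !orbT.
  - by rewrite /children in_set Hw Hb eqxx.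
  - by rewrite /opt Hw Hb set11 !orbT.
  - by rewrite /opt Hw Hb set11 !orbT.
Qed.


(** The saturated vertices in the tree of [r] have [k.-1 * #|Z|] distinct children, all in that
    tree, different from [r] and not adjacent to [r]. Neighbours of [r] in the other tree are
    saturated by hypothesis, so there are at most [#|Zt|] of them. *)
Lemma saturated_degree n k (G : rel 'I_n) (R : {set 'I_n}) f r t :
  symmetric G -> irreflexive G -> r \in R ->
  (forall x, fconnect f x r || fconnect f x t) ->
  (forall y, fconnect f y t -> G r y -> y \in saturated G R k f t) ->
  degree G r + 1 + k.-1 * #|saturated G R k f r| <=
    #|[set x | fconnect f x r]| + #|saturated G R k f t|.
Proof.
move=> symG irrG rR cov adj.
set Sr := [set x | _]; set Z := saturated _ _ _ _ r; set Zt := saturated _ _ _ _ _ in adj *.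
pose CH := [set c | (c \notin R) && (f c \in Z)].
have ZE x : x \in Z -> [/\ fconnect f x r, #|children R f x| = k.-1 &
    forall c, c \in children R f x -> ~~ G c r].
  by rewrite inE => /and4P[? _ /eqP ? /forall_inP].
clearbody Z Zt.
have CHk : #|CH| = k.-1 * #|Z|.
  rewrite -sum1_card (partition_big f (mem Z)) /=; last by move=> c; rewrite inE => /andP[].
  rewrite mulnC -sum_nat_const; apply: eq_bigr => x xZ.
  have [_ <- _] := ZE x xZ; rewrite -sum1_card; apply: eq_bigl => c.
  by rewrite !inE -andbA; case: (f c =P x) => [->|]; rewrite ?xZ ?andbF.
have CHS : CH \subset Sr :\ r.
  apply/subsetP=> c; rewrite !inE => /andP[cR fcZ]; have [fcr _ _] := ZE _ fcZ.
  apply/andP; split; first by apply: contraNneq cR => ->.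
  exact: connect_trans (fconnect1 f c) fcr.
have rS : r \in Sr by rewrite inE connect0.
have NG : [set y | G r y] \subset ((Sr :\ r) :\: CH) :|: Zt.
  apply/subsetP=> y; rewrite !inE => Gry.
  have yr : y != r by apply: contraTneq Gry => ->; rewrite irrG.
  have [yt|nyt] := boolP (fconnect f y t); first by rewrite adj ?orbT.
  have := cov y; rewrite (negbTE nyt) orbF => ->; rewrite yr /= andbT.
  apply/orP; left; apply/andP; case=> yR fyZ; have [_ _ /(_ y)] := ZE _ fyZ.
  by rewrite inE yR eqxx symG Gry => /(_ isT).
have := leq_trans (subset_leq_card NG) (leq_card_setU _ _).
rewrite cardsDS // (cardsD1 r Sr) rS /degree -CHk.
have := subset_leq_card CHS.
by move: #|CH| #|Sr :\ r| #|Zt| #|[set y | G r y]| => a b c e; lia.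
Qed.

(** If no edge can rejoin the halves, adding the bounds of [saturated_degree] at [u] and [v] gives
    d(u) + d(v) + 2 + (k-2)(|Zu| + |Zv|) <= n. With |Zu| + |Zv| >= m this contradicts the degree
    hypothesis. *)
Lemma closure_step n k m (G : rel 'I_n) u v :
  symmetric G -> irreflexive G -> m_connected m G -> 1 < k -> u != v -> ~~ G u v ->
  n <= degree G u + degree G v + 1 + (k - 2) * m ->
  conn_bounded k (add_edge G u v) -> conn_bounded k G.
Proof.
move=> symG irrG [mn conG] k1 uv nGuv degs [T [symT TG conT degT]].
pose R := [set u; v]; have RE : R = [set u; v] by []; clearbody R.
pose e := [rel a b | T a b && G a b].
have uR : u \in R by rewrite RE !inE eqxx.
have vR : v \in R by rewrite RE !inE eqxx orbT.
have RP r : r \in R -> r = u \/ r = v by rewrite RE !inE => /pred2P.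
have [Tuv|nTuv] := boolP (T u v); last first.
  exists T; split=> // a b Tab; have := TG _ _ Tab; rewrite /add_edge.
  case/or3P=> // /andP[/eqP Ea /eqP Eb]; move: Tab nTuv; rewrite Ea Eb; last rewrite symT.
    by move=> ->.
  by move=> ->.
have eT a b : T a b -> ~~ e a b -> (a \in R) && (b \in R).
  move=> Tab; rewrite /e /= Tab /= => nG; have := TG _ _ Tab; rewrite /add_edge (negbTE nG) /=.
  by case/orP=> /andP[/eqP-> /eqP->]; rewrite ?uR ?vR.
(* A [T]-path from [a] to [u] can leave the [e]-component of [a] only through the edge [u v], hence
   at [u] or [v]. *)
have reach a : exists2 r, r \in R & connect e a r.
  have [au|nau] := boolP (connect e a u); first by exists u.
  have [x [y [Txy ax nay]]] := connect_cross (conT a u) (connect0 e a) nau.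
  have nexy : ~~ e x y.
    by apply: contra nay => exy; apply: connect_trans ax _; apply: connect1.
  by exists x => //; have /andP[] := eT _ _ Txy nexy.
have [f [d [fR fe]]] := parent_function reach.
have fd x : x \notin R -> d (f x) < d x by case/fe.
have Ff : forest G R f.
  split=> // [x /fe[/andP[]] //|x]; exact: rank_fconnect fd x.
(* Every vertex has a [T]-neighbour that is not its child: its parent or, for a root, the other
   root. *)
have chk w : #|children R f w| < k.
  have sub z : T w z -> z \notin children R f w -> #|children R f w| < k.
    move=> Twz nz; apply: leq_trans (degT w); apply: proper_card.
    apply/properP; split; last by exists z => //; rewrite inE.
    apply/subsetP=> c; rewrite !inE => /andP[/fe[/andP[Tc _] _] /eqP <-].
    by rewrite symT.
  have [wR|wR] := boolP (w \in R); last first.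
    apply: (sub (f w)); first by have [/andP[]] := fe w wR.
    apply/negP; rewrite inE => /andP[fwR /eqP ffw].
    by have := fd _ fwR; rewrite ffw ltnNge ltnW // fd.
  have [wu|wv] := RP w wR; first by apply: (sub v); rewrite ?wu // inE vR.
  by apply: (sub u); rewrite ?wv 1?symT // inE uR.
have side x : fconnect f x u || fconnect f x v.
  by have [_ _ /(_ x)[r /RP[->|->] ->]] := Ff; rewrite ?orbT.
have sideN g x : forest G R g -> fconnect g x u -> ~~ fconnect g x v.
  move=> Fg xu; apply: contra uv => xv.
  by rewrite (forest_root_unique Fg uR vR xu xv).
set Zu := saturated G R k f u; set Zv := saturated G R k f v.
(* Given an edge between unsaturated vertices of the two trees, a slot is freed at [x] first. This
   leaves the children in the tree of [v] unchanged, so [y] stays unsaturated and a slot is freed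
   there next. *)
have [/existsP[x /existsP[y /and5P[xu yv Gxy xZ yZ]]]|cover] :=
  boolP [exists x, exists y, [&& fconnect f x u, fconnect f y v, G x y,
     x \notin Zu & y \notin Zv]].
  have [g1 [Fg1 side1 deg1 ch1]] := free_slot k1 Ff uR (fun w _ => chk w) xu xZ.
  have side1N w : fconnect g1 w v -> ~~ fconnect f w u.
    by move=> wv; apply: contraL wv => /(side1 _ _ uR); apply: sideN.
  have yv1 : fconnect g1 y v by apply: side1.
  have yZ1 : y \notin saturated G R k g1 v.
    by move: yZ; rewrite !inE yv yv1 ch1 // side1N.
  have [|g2 [Fg2 side2 deg2 ch2]] := free_slot k1 Fg1 vR _ yv1 yZ1.
    by move=> w /side1N nw; rewrite ch1.
  rewrite RE in Fg2.
  apply: (forest_join symG Fg2 _ _ Gxy); [exact: side2 (side1 _ _ uR xu)|exact: side2|].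
  rewrite -RE => w; have [wu|nwu] := boolP (fconnect f w u).
    have wu1 := side1 _ _ uR wu; rewrite ch2; last exact: sideN.
    have /negbTE -> : w != y by apply: contraTneq wu1 => ->; apply: contraL yv1; apply: sideN.
    by rewrite addn0 deg1.
  have wv1 : fconnect g1 w v by apply: side1 => //; have := side w; rewrite (negbTE nwu).
  have /negbTE -> : w != x by apply: contraNneq nwu => ->.
  by rewrite addn0 deg2.
have {}cover x y : fconnect f x u -> fconnect f y v -> G x y -> (x \in Zu) || (y \in Zv).
  move=> xu yv Gxy; apply/negPn/negP; rewrite negb_or => /andP[xZ yZ].
  case/negP: cover; apply/existsP; exists x; apply/existsP; exists y.
  by rewrite xu yv Gxy xZ yZ.
have ZR t w : w \in R -> w \notin saturated G R k f t by rewrite inE => ->; rewrite /= andbF.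
(* Roots are never saturated, so removing fewer than [m] saturated vertices would leave [u] and [v]
   connected, and the connecting path would cross between the trees along an edge forbidden by
   [cover]. *)
have mZ : m <= #|Zu| + #|Zv|.
  apply: leq_trans (leq_card_setU _ _); rewrite leqNgt; apply/negP=> /conG /(_ u v).
  rewrite !in_setU !negb_or !ZR // => /(_ isT isT) con.
  have fvu : ~~ fconnect f v u by apply/negP=> vu; have := sideN _ _ Ff vu; rewrite connect0.
  have [x [y [/and3P[Gxy xZ yZ] xu yu]]] := connect_cross (P := fun z => fconnect f z u) con (connect0 _ u) fvu.
  have yv : fconnect f y v by have := side y; rewrite (negbTE yu).
  move: xZ yZ; rewrite !in_setU; have /orP[->|->] := cover _ _ xu yv Gxy => //.
  by rewrite orbT.
have du : degree G u + 1 + k.-1 * #|Zu| <= #|[set x | fconnect f x u]| + #|Zv|.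
  apply: saturated_degree => // y yv Guy.
  by have := cover u y (connect0 _ u) yv Guy; rewrite (negbTE (ZR _ _ uR)).
have dv : degree G v + 1 + k.-1 * #|Zv| <= #|[set x | fconnect f x v]| + #|Zu|.
  apply: saturated_degree => // [x|y yu Gvy]; first by rewrite orbC.
  have := cover y v yu (connect0 _ v); rewrite symG Gvy (negbTE (ZR _ _ vR)) orbF.
  by move/(_ isT).
have Sn : #|[set x | fconnect f x u]| + #|[set x | fconnect f x v]| <= n.
  rewrite -[X in _ <= X]card_ord -(cardsC [set x | fconnect f x u]) leq_add2l.
  apply: subset_leq_card; apply/subsetP=> x; rewrite !inE => xv.
  by apply/negP=> /(sideN _ _ Ff); rewrite xv.
have kE : k.-1 = (k - 2).+1 by lia.
have : (k - 2) * m <= (k - 2) * (#|Zu| + #|Zv|) by rewrite leq_mul2l mZ orbT.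
by move: du dv; rewrite kE !mulSn mulnDr; lia.
Qed.

(** * The structure of dense closed graphs *)

(** The Hamiltonian path through the vertices in numerical order has maximum degree at most 2. *)
Lemma complete_conn_bounded n k (G : rel 'I_n) :
  1 < k -> (forall x y, x != y -> G x y) -> conn_bounded k G.
Proof.
move=> k1 Gc; pose T : rel 'I_n := fun x y => (x.+1 == y) || (y.+1 == x).
have symT : symmetric T by move=> x y; rewrite /T orbC.
exists T; split=> //.
- by move=> x y xy; apply: Gc; apply/eqP=> E; move: xy; rewrite /T E; lia.
- have le i : forall x y : 'I_n, x + i = y -> connect T x y.
    elim: i => [|i IH] x y; first by rewrite addn0 => /val_inj ->.
    move=> E; have lt : x.+1 < n by have := ltn_ord y; lia.
    apply: (@connect_trans _ _ (Ordinal lt)); last by apply: IH; rewrite /= addSnnS.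
    by apply: connect1; rewrite /T /= eqxx.
  move=> x y; have [xy|/ltnW yx] := leqP x y; first by apply: (le (y - x)); lia.
  by rewrite (sym_connect_sym symT); apply: (le (x - y)); lia.
- move=> x; apply: leq_trans k1; rewrite /degree cardE -(size_map val).
  apply: (@uniq_leq_size _ _ [:: x.+1; x.-1]).
    by rewrite (map_inj_uniq val_inj) enum_uniq.
  by move=> i /mapP[y]; rewrite mem_enum !inE /T => /orP[] /eqP xy -> {i}; rewrite -[val y]/(nat_of_ord y) ?xy -?xy eqxx ?orbT.
Qed.

(** Fewer than [m] neighbours would separate [x] from some remaining vertex, which exists because
    [m < n]. *)
Lemma min_degree n m (G : rel 'I_n) x :
  irreflexive G -> m_connected m G -> m <= degree G x.
Proof.
move=> irrG [mn conG]; rewrite leqNgt; apply/negP=> lt.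
pose N := [set y | G x y].
have [z zN] : exists z, z \notin x |: N.
  apply/existsP; rewrite -negb_forall; apply/negP=> /forallP all.
  have : #|x |: N| = n by rewrite -[RHS]card_ord; apply: eq_card => z; rewrite all.
  by rewrite cardsU1 inE irrG add1n => E; by move: mn; rewrite -E ltnS leqNgt lt.
move: zN; rewrite in_setU1 negb_or => /andP[zx zN].
have xN : x \notin N by rewrite inE irrG.
have [a [b [/and3P[Gab _ bN] /eqP ax _]]] :=
  connect_cross (P := pred1 x) (conG N lt x z xN zN) (eqxx x) zx.
by move: bN; rewrite inE -ax Gab.
Qed.

(** * Counting nonadjacent pairs *)

Section Counting.

Variables (n : nat) (G : rel 'I_n).

(** The degree of [x] in the complement graph. *)
Definition codegree (x : 'I_n) : nat := #|[set y | (y != x) && ~~ G x y]|.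

Lemma codegreeE x : irreflexive G -> degree G x + codegree x = n.-1.
Proof.
move=> irrG; have <- : #|[set~ x]| = n.-1 by rewrite cardsC1 card_ord.
rewrite -(cardsID [set y | G x y] [set~ x]); congr (_ + _); apply: eq_card => y.
  by rewrite !inE; case: eqP => // ->; rewrite irrG.
by rewrite !inE andbC.
Qed.

(** Nonadjacent pairs between [L] and its complement count at both ends: each vertex of [L] has at
    least [n - #|L| - degree G x] non-neighbours outside [L], and these pairs bound the codegrees
    outside [L] from below. *)
Lemma codegree_sum_ge (L : {set 'I_n}) : symmetric G -> irreflexive G ->
  \sum_(x in L) (codegree x + (n - #|L| - degree G x)) <= \sum_x codegree x.
Proof.
move=> symG irrG; rewrite [X in _ <= X](bigID (mem L)) /= big_split /= leq_add2l.
have cnt (A b : pred 'I_n) : \sum_(y | A y) b y = #|[set y | A y && b y]|.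
  by rewrite -sum1dep_card big_mkcondr; apply: eq_bigr => y _; case: (b y).
have bd x : x \notin L -> \sum_(y in L) ~~ G y x <= codegree x.
  move=> xL; rewrite (cnt _ (fun y => ~~ G y x)); apply: subset_leq_card.
  apply/subsetP=> y; rewrite !inE => /andP[yL nG]; rewrite symG nG andbT.
  by apply: contraNneq xL => <-.
apply: (@leq_trans (\sum_(x | x \notin L) \sum_(y in L) ~~ G y x)); last exact: leq_sum.
rewrite exchange_big /=; apply: leq_sum => y yL.
rewrite (cnt _ (fun x => ~~ G y x)) -subnDA leq_subLR.
have sub : [set: 'I_n] \subset L :|: [set z | G y z] :|: [set x | (x \notin L) && ~~ G y x].
  by apply/subsetP=> z _; rewrite !inE; case: (z \in L); case: (G y z).
have := subset_leq_card sub; rewrite cardsT card_ord => /leq_trans; apply.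
apply: leq_trans (leq_card_setU _ _) _; apply: leq_add; first exact: leq_card_setU.
by apply: subset_leq_card; apply/subsetP=> z; rewrite !inE.
Qed.

End Counting.

(** The left side is a concave quadratic in [l], compared with its value at the first forbidden
    point l0 = q + m + 2. The second bound on [n] makes the inequality fail at l0. *)
Lemma low_degree_count_bound n q m l : 0 < m ->
  7 * q + 12 * m + 4 <= n -> 2 * (q + m) * m + 3 * q + 7 * m + 9 <= 2 * n ->
  l < 4 * (q + m + 1) ->
  l * (n - l + q + (n - l - (l - 1 - q))) + (q + m + 1) * (q + m + 3) <= 2 * (q + m + 1) * n ->
  l <= q + m + 1.
Proof.
move=> m0 h1 h2 h3; rewrite leqNgt => h4; apply/negP=> h5.
have {}h4 : l * (2 * n + 2 * q + 1) + (q + m + 1) * (q + m + 3) <=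
    2 * (q + m + 1) * n + 3 * l * l.
  set A := n - l + q + _ in h4; have hA : 2 * n + 2 * q + 1 <= A + 3 * l by rewrite /A; lia.
  clearbody A; have := leq_mul (leqnn l) hA; nia.
(* Writing F(l) = l(2n + 2q + 1 - 3l), one has F(l) - F(l0) = (l - l0)(2n + 2q + 1 - 3(l + l0)),
   which is nonnegative in the first case. The second case is incompatible with [h1] and [h3]. *)
have [c|c] := leqP (3 * (l + (q + m + 2))) (2 * n + 2 * q + 1).
  by nia.
nia.
Qed.

(** Complementation, with the identity n(n-1) - (n-t-1)^2 - (n-1) = 2tn - t(t+2). Substituting
    [n = t.+1 + a] removes the truncated subtractions. *)
Lemma codegree_sum_le n t (G : rel 'I_n) : irreflexive G -> t < n ->
  (n - t.+1) ^ 2 + n.-1 <= \sum_x degree G x ->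
  \sum_x codegree G x + t * (t + 2) <= 2 * t * n.
Proof.
move=> irrG tn; have : \sum_x degree G x + \sum_x codegree G x = n * n.-1.
  rewrite -big_split /= (eq_bigr (fun=> n.-1)); last by move=> x _; apply: codegreeE.
  by rewrite sum_nat_const card_ord.
move: (\sum_x _) (\sum_x _) => D E.
have [a ->] : exists a, n = t.+1 + a by exists (n - t.+1); lia.
have -> : t.+1 + a - t.+1 = a by lia.
by rewrite addSn /=; nia.
Qed.

(** The low-degree set [L] is chosen so that closedness makes its complement a clique. Counting
    gives [#|L| <= q + m + 1]; if [L] is nonempty, the minimum degree [m] forces equality and degree
    exactly [m] on [L]. All vertices of [L] then have the same neighbourhood [M]. *)
Lemma closed_structure n q m (G : rel 'I_n) :
  symmetric G -> irreflexive G -> m_connected m G -> 0 < m ->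
  7 * q + 12 * m + 4 <= n -> 2 * (q + m) * m + 3 * q + 7 * m + 9 <= 2 * n ->
  (n - (q + m + 2)) ^ 2 + n.-1 <= \sum_x degree G x ->
  (forall u v, u != v -> ~~ G u v -> degree G u + degree G v + 1 + q < n) ->
  (forall x y, x != y -> G x y) \/
  exists M L : {set 'I_n}, [/\ #|M| = m, #|L| = q + m + 1, [disjoint M & L] &
    forall x y, G x y -> [|| x \in M, y \in M | (x \notin L) && (y \notin L)]].
Proof.
move=> symG irrG conG m0 n1 n2 sumG cl.
pose L := [set x | 2 * degree G x + 2 + q <= n].
have LE x : (x \in L) = (2 * degree G x + 2 + q <= n) by rewrite inE.
have cle : \sum_x codegree G x + (q + m + 1) * (q + m + 3) <= 2 * (q + m + 1) * n.
  have -> : q + m + 3 = q + m + 1 + 2 by lia.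
  by apply: codegree_sum_le => //; [lia | rewrite -addn1 -addnA].
have cod x := codegreeE x irrG.
clearbody L.
have Kadj x y : x \notin L -> y \notin L -> x != y -> G x y.
  by rewrite !LE => xL yL xy; apply/negPn/negP=> /(cl _ _ xy); lia.
(* Each vertex of [L] has codegree at least (n + q)/2, so the codegree sum gives a first crude bound
   on [#|L|]. *)
have L4 : #|L| < 4 * (q + m + 1).
  have : #|L| * (n + q) <= 2 * \sum_x codegree G x.
    rewrite big_distrr /= -sum_nat_const [X in _ <= X](bigID (mem L)) /=.
    apply: leq_trans (leq_addr _ _); apply: leq_sum => x; rewrite LE => xL.
    by have := cod x; lia.
  move: cle n1; move: (\sum_x _) #|L| => S l; nia.
(* A vertex [w] outside [L] has at most [#|L|] non-neighbours; if it misses [u], closedness gives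
   the bound. Otherwise [u] is adjacent to all of the complement of [L], which is too large for a
   low-degree vertex by [L4]. *)
have Ldeg u : u \in L -> degree G u + q < #|L|.
  move=> uL; have [/existsP[w /andP[wL nG]]|adj] := boolP [exists w, (w \notin L) && ~~ G u w].
    have uw : u != w by apply: contraNneq wL => <-.
    have := cl _ _ uw nG.
    have cw : codegree G w <= #|L|.
      apply: subset_leq_card; apply/subsetP=> y; rewrite inE => /andP[yw nGwy].
      by apply: contraR nGwy => yL; apply: Kadj; rewrite // eq_sym.
    by have := cod w; lia.
  have : #|~: L| <= degree G u.
    apply: subset_leq_card; apply/subsetP=> w; rewrite !inE => wL.
    by apply: contraR adj => nG; apply/existsP; exists w; rewrite wL.
  have cC : #|L| + #|~: L| = n by rewrite cardsC card_ord.
  move: uL; rewrite LE; move: L4 cC n1 m0.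
  move: #|L| #|~: L| (degree G u) => a b c; clear; lia.
have Lle : #|L| <= q + m + 1.
  apply: (low_degree_count_bound m0 n1 n2 L4); apply: leq_trans cle; rewrite leq_add2r.
  apply: leq_trans (codegree_sum_ge L symG irrG); rewrite -sum_nat_const.
  apply: leq_sum => x xL; have := Ldeg x xL; have := cod x.
  have : #|L| <= n by rewrite -[X in _ <= X]card_ord max_card.
  move: n1; move: #|L| (degree G x) (codegree G x) => a b c; clear; lia.
have [L0|[u0 u0L]] := set_0Vmem L; first by left=> x y; apply: Kadj; rewrite L0 inE.
right.
have md u : m <= degree G u by apply: min_degree.
have Lc : #|L| = q + m + 1 by have := Ldeg _ u0L; have := md u0; lia.
have Ld u : u \in L -> degree G u = m by move=> /Ldeg; have := md u; lia.
pose M := [set w | (w \notin L) && [exists u in L, G u w]].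
have MP w : reflect (w \notin L /\ exists2 u, u \in L & G u w) (w \in M).
  rewrite inE; apply: (iffP andP) => [[? /exists_inP[u]]|[? [u uL Guw]]].
    by split=> //; exists u.
  by split=> //; apply/exists_inP; exists u.
clearbody M.
(* If [w] in [M] missed [u], closedness would give it codegree at least [#|L|]; but its
   non-neighbours lie in [L] and omit its neighbour [u1]. *)
have MN u : u \in L -> M \subset [set y | G u y].
  move=> uL; apply/subsetP=> w /MP[wL [u1 u1L Gu1w]]; rewrite inE; apply/negPn/negP=> nG.
  have uw : u != w by apply: contraNneq wL => <-.
  have := cl _ _ uw nG; rewrite Ld //.
  have cw : codegree G w < #|L|.
    apply: proper_card; apply/properP; split; last first.
      by exists u1; rewrite // inE symG Gu1w andbF.
    apply/subsetP=> y; rewrite inE => /andP[yw nGwy].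
    by apply: contraR nGwy => yL; apply: Kadj; rewrite // eq_sym.
  by have := cod w; lia.
have Mle : #|M| <= m by rewrite -(Ld _ u0L) subset_leq_card ?MN.
(* Every edge leaving [L] ends in [M], so a smaller [M] would be a cut separating [L] from the
   remaining vertices. *)
have Mge : m <= #|M|.
  rewrite leqNgt; apply/negP=> lt; have [_ /(_ M lt) con] := conG.
  have [z zML] : exists z, z \notin M :|: L.
    apply/existsP; rewrite -negb_forall; apply/negP=> /forallP all.
    have : #|M :|: L| = n by rewrite -[RHS]card_ord; apply: eq_card => z; rewrite all.
    have [le _] := leq_card_setU M L; move: le; rewrite Lc => le E; lia.
  move: zML; rewrite in_setU negb_or => /andP[zM zL].
  have u0M : u0 \notin M by apply/negP=> /MP[]; rewrite u0L.
  have [x [y [/and3P[Gxy xM yM] xL yL]]] := connect_cross (P := mem L) (con _ _ u0M zM) u0L zL.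
  by case/negP: yM; apply/MP; split=> //; exists x.
have NE u y : u \in L -> G u y -> y \in M.
  move=> uL Guy; have /eqP -> : M == [set y | G u y].
    by rewrite eqEcard MN //= -/(degree G u) Ld.
  by rewrite inE.
exists M, L; split=> //; first by apply/eqP; rewrite eqn_leq Mle Mge.
  by rewrite disjoints_subset; apply/subsetP=> w /MP[]; rewrite inE.
move=> x y Gxy; have [xL|xL] := boolP (x \in L); first by rewrite (NE x y) ?orbT.
have [yL|yL] := boolP (y \in L); last by rewrite !orbT.
by rewrite (NE y x) // symG.
Qed.

(** Each vertex is sent to its position in the list that runs through [M], then the remaining
    vertices, then [L]. *)
Lemma block_perm n (M L : {set 'I_n}) : [disjoint M & L] ->
  exists f : {perm 'I_n}, forall x, (x \in M) = (f x < #|M|) /\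
    (x \in L) = (n - #|L| <= f x).
Proof.
move=> dML; pose R := ~: (M :|: L); pose s := enum M ++ enum R ++ enum L.
have sall x : x \in s by rewrite !mem_cat !mem_enum !inE; case: (x \in M); case: (x \in L).
have us : uniq s.
  rewrite !cat_uniq !enum_uniq /= andbT; apply/andP; split; apply/hasPn=> x.
    rewrite mem_cat !mem_enum !inE => /orP[|xL]; first by rewrite negb_or => /andP[].
    by apply: contraL xL => xM; rewrite (disjointFr dML).
  by rewrite !mem_enum !inE => ->; rewrite orbT.
have ss : size s = n by rewrite -[RHS](size_enum_ord); apply/perm_size/uniq_perm;
  rewrite ?enum_uniq // => x; rewrite sall mem_enum.
have ix x : index x s < n by rewrite -[X in _ < X]ss index_mem.
have finj : injective (fun x => Ordinal (ix x)).
  move=> x y /(congr1 val) /= E; rewrite -(nth_index x (sall x)) E nth_index //.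
exists (perm finj) => x; rewrite permE /= /s !index_cat !mem_enum -!cardE.
have sz : #|M| + #|R| + #|L| = n by rewrite -[RHS]ss !size_cat -!cardE addnA.
have /= := congr1 (subn^~ #|L|) sz; rewrite addnK => /esym nL.
have [xM|xM] := boolP (x \in M).
  have i1 : index x (enum M) < #|M| by rewrite cardE index_mem mem_enum.
  rewrite (disjointFr dML xM) i1; split=> //; apply/esym/negbTE; rewrite -ltnNge.
  by apply: leq_trans i1 _; rewrite nL leq_addr.
have xR : (x \in R) = (x \notin L) by rewrite inE in_setU (negbTE xM).
rewrite xR; split; first by rewrite ltnNge leq_addr.
have [xL|xL] := boolP (x \in L); rewrite nL leq_add2l /=; first by rewrite leq_addr.
by apply/esym/negbTE; rewrite -ltnNge cardE index_mem mem_enum xR.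
Qed.

Lemma add_edge_sym n (G : rel 'I_n) u v : symmetric G -> symmetric (add_edge G u v).
Proof.
move=> symG x y; rewrite /add_edge symG [(y == u) && _]andbC [(y == v) && _]andbC.
by congr (_ || _); rewrite orbC.
Qed.

Lemma m_connected_sub n m (G H : rel 'I_n) :
  subrel G H -> m_connected m G -> m_connected m H.
Proof.
move=> GH [mn con]; split=> // S /con cS x y xS yS; apply: connect_sub (cS x y xS yS).
move=> a b /and3P[/GH Hab aS bS]; apply: connect1; exact/and3P.
Qed.

(** Induction on the number of nonadjacent ordered pairs: adding an edge preserves every hypothesis,
    [closure_step] carries a bounded connected subgraph back, and an embedding of the larger graph
    restricts to [G]. A closed graph falls under [closed_structure]. *)
Theorem dense_conn_bounded n m k (G : rel 'I_n) :
  0 < m -> 1 < k -> symmetric G -> irreflexive G -> m_connected m G ->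
  (7 * k - 2) * m + 4 <= n ->
  2 * (k - 1) * m ^ 2 + (3 * k + 1) * m + 9 <= 2 * n ->
  (n - ((k - 1) * m + 2)) ^ 2 + n.-1 <= \sum_x degree G x ->
  conn_bounded k G \/
  exists f : {perm 'I_n}, forall x y, G x y -> extremal_graph n m k (f x) (f y).
Proof.
move=> m0 k1 symG irrG conG n1 n2.
(* Setting q = (k-2)m turns (k-1)m into q + m and km into q + 2m, which eliminates [k] from the
   arithmetic. *)
have [q Eq] : exists q, q = (k - 2) * m by eexists.
have kE : (k - 1) * m = q + m by rewrite Eq -mulSnr; congr (_ * _); lia.
have km : k * m = q + 2 * m by rewrite Eq -mulnDl; congr (_ * _); lia.
have h1 : 7 * q + 12 * m + 4 <= n.
  by move: n1; rewrite mulnBl -mulnA km; lia.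
have h2 : 2 * (q + m) * m + 3 * q + 7 * m + 9 <= 2 * n.
  move: n2; rewrite mulnDl -!mulnA km expnS expn1 [(k - 1) * _]mulnA kE; lia.
rewrite kE; have [N] := ubnP #|[set p : 'I_n * 'I_n | ~~ G p.1 p.2]|.
elim: N G symG irrG conG => // N IH G symG irrG conG leN sumG.
have [/existsP[u /existsP[v /and3P[uv nG deg]]]|none] := boolP [exists u, exists v,
    [&& u != v, ~~ G u v & n <= degree G u + degree G v + 1 + q]].
  pose H := add_edge G u v.
  have GH : subrel G H by move=> a b Gab; rewrite /H /add_edge Gab.
  have symH : symmetric H by apply: add_edge_sym.
  have irrH : irreflexive H.
    move=> a; rewrite /H /add_edge irrG /=.
    by have [->|_] := eqVneq a u; rewrite ?(negbTE uv) ?andbF.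
  have [|||con|[f Hf]] := IH H symH irrH; first exact: m_connected_sub conG.
  - rewrite ltnS in leN; apply: leq_trans leN; apply: proper_card; apply/properP; split.
      by apply/subsetP=> p; rewrite !inE; apply: contra; apply: GH.
    by exists (u, v); rewrite !inE //= /H /add_edge !eqxx orbT.
  - apply: leq_trans sumG _; apply: leq_sum => x _; apply: subset_leq_card.
    by apply/subsetP=> y; rewrite !inE; apply: GH.
  - by left; apply: (closure_step symG irrG conG k1 uv nG _ con); rewrite -Eq.
  - by right; exists f => x y /GH; apply: Hf.
have cl u v : u != v -> ~~ G u v -> degree G u + degree G v + 1 + q < n.
  move=> uv nG; rewrite ltnNge; apply: contra none => deg.
  by apply/existsP; exists u; apply/existsP; exists v; rewrite uv nG.
have [Gc|[M [L [cM cL dML GML]]]] := closed_structure symG irrG conG m0 h1 h2 sumG cl.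
  by left; apply: complete_conn_bounded.
right; have [f Hf] := block_perm dML; exists f => x y Gxy.
have [[xM xL] [yM yL]] := (Hf x, Hf y).
have fxy : f x != f y by rewrite (inj_eq perm_inj); apply: contraTneq Gxy => ->; rewrite irrG.
have Lt z : (f z < m + (n - k * m - 1)) = (z \notin L).
  have [_ ->] := Hf z; rewrite -ltnNge cL; congr (_ < _); lia.
by rewrite /extremal_graph fxy !Lt -cM -xM -yM GML.
Qed.

(** * Spectral radius *)

Local Open Scope ring_scope.
Local Open Scope sesquilinear_scope.

(** In unitary coordinates [w] the form is the sum of D_i |w_i|^2 with every D_i at most [r].
    Equality forces w_i = 0 wherever D_i differs from [r], so [v] satisfies the eigenvector equation
    for [r]. *)
Lemma spectral_radius_rayleigh n (A : 'M[algC]_n) r (v : 'rV_n) :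
  A \is hermsymmx -> spectral_radius A r ->
  (v *m A *m v^t*) 0 0 <= r * (v *m v^t*) 0 0 /\
  (r * (v *m v^t*) 0 0 <= (v *m A *m v^t*) 0 0 -> v *m A = r *: v).
Proof.
move=> Ah [[l _ lr] rmax].
pose P := spectralmx A; pose D := spectral_diag A.
have Pu : P \is unitarymx by apply: spectral_unitarymx.
have AE : A = P^t* *m diag_mx D *m P.
  by have /hermitian_normalmx/orthomx_spectralP := Ah; rewrite invmx_unitary.
have PA : P *m A = diag_mx D *m P.
  by rewrite {1}AE !mulmxA (unitarymxP _) ?mul1mx.
have Dr i : D 0 i <= r.
  have Dreal : D 0 i \is Num.real by have /mxOverP := hermitian_spectral_diag_real Ah.
  apply: le_trans (real_ler_norm Dreal) (rmax _ _).
  apply/eigenvalueP; exists (row i P).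
    by apply/rowP=> j; rewrite -row_mul PA mul_diag_mx !mxE.
  (* A row of the unitary matrix [P] is nonzero, since it has norm 1. *)
  apply/eqP=> P0; have /matrixP/(_ i i) := unitarymxP Pu.
  rewrite !mxE eqxx big1 => [/eqP|j _]; first by rewrite eq_sym oner_eq0.
  by have /rowP/(_ j) := P0; rewrite !mxE => ->; rewrite mul0r.
pose w := v *m P^t*.
have wP : w *m P = v by apply: mulmxKtV.
have wt : w^t* = P *m v^t* by rewrite /w trmx_mul map_mxM trmxCK.
clearbody w.
have vA : v *m A = w *m diag_mx D *m P by rewrite -[in LHS]wP -mulmxA PA mulmxA.
have vAv : (v *m A *m v^t*) 0 0 = \sum_i D 0 i * `|w 0 i| ^+ 2.
  rewrite vA -mulmxA -wt mxE; apply: eq_bigr => i _.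
  by rewrite mul_mx_diag !mxE normCK [w 0 i * D 0 i]mulrC mulrA.
have vv : (v *m v^t*) 0 0 = \sum_i `|w 0 i| ^+ 2.
  have -> : v *m v^t* = w *m w^t* by rewrite wt mulmxA wP.
  by rewrite mxE; apply: eq_bigr => i _; rewrite !mxE normCK.
rewrite vAv vv mulr_sumr; split.
  by apply: ler_sum => i _; rewrite ler_wpM2r // exprn_ge0.
move=> ge.
have /eqP : \sum_i (r - D 0 i) * `|w 0 i| ^+ 2 = 0.
  apply/eqP; rewrite eq_le; apply/andP; split; last first.
    by apply: sumr_ge0 => i _; rewrite mulr_ge0 ?subr_ge0 ?exprn_ge0.
  under eq_bigr => i _ do rewrite mulrBl.
  by rewrite sumrB subr_le0.
rewrite psumr_eq0 => [/allP z|i _]; last by rewrite mulr_ge0 ?subr_ge0 ?exprn_ge0.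
rewrite vA -wP scalemxAl; congr (_ *m _).
apply/rowP=> i; rewrite mul_mx_diag !mxE mulrC.
have := z i (mem_index_enum i); rewrite mulf_eq0 expf_eq0 /= normr_eq0 subr_eq0.
by case/orP=> /eqP ->; rewrite ?mulr0.
Qed.

Lemma adjmx_hermsym n (G : rel 'I_n) : symmetric G -> adjmx G \is hermsymmx.
Proof.
move=> symG; apply/is_hermitianmxP; rewrite expr0 scale1r.
by apply/matrixP=> i j; rewrite !mxE symG conjC_nat.
Qed.

Lemma spectral_radius_sum n (G : rel 'I_n) r (y : 'I_n -> algC) :
  symmetric G -> spectral_radius (adjmx G) r -> (forall i, 0 <= y i) ->
  \sum_i y i * \sum_j (G i j)%:R * y j <= r * \sum_i y i ^+ 2 /\
  (r * \sum_i y i ^+ 2 <= \sum_i y i * \sum_j (G i j)%:R * y j ->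
   forall i, \sum_j (G i j)%:R * y j = r * y i).
Proof.
move=> symG rG y0; have [le eq] := spectral_radius_rayleigh (\row_i y i) (adjmx_hermsym symG) rG.
pose v := \row_i y i.
have vA i : (v *m adjmx G) 0 i = \sum_j (G i j)%:R * y j.
  by rewrite mxE; apply: eq_bigr => j _; rewrite !mxE symG mulrC.
have vv : (v *m v^t*) 0 0 = \sum_i y i ^+ 2.
  by rewrite mxE; apply: eq_bigr => i _; rewrite !mxE geC0_conj.
have vAv : (v *m adjmx G *m v^t*) 0 0 = \sum_i y i * \sum_j (G i j)%:R * y j.
  by rewrite mxE; apply: eq_bigr => i _; rewrite vA !mxE geC0_conj // mulrC.
rewrite -vv -vAv; split=> // /eq /rowP E i.
by rewrite -vA E !mxE.
Qed.

(** The triangle inequality, applied to each coordinate of the eigenvector equation, leaves an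
    inequality for the absolute values. *)
Lemma abs_eigenvector n (G : rel 'I_n) l :
  symmetric G -> eigenvalue (adjmx G) l -> exists y : 'I_n -> algC,
  [/\ forall i, 0 <= y i, exists i, y i != 0 &
      forall i, `|l| * y i <= \sum_j (G i j)%:R * y j].
Proof.
move=> symG /eigenvalueP[v /rowP vA v0]; exists (fun i => `|v 0 i|); split=> //.
  apply/existsP; rewrite -negb_forall; apply: contra v0 => /forallP v0.
  by apply/eqP/rowP=> i; rewrite mxE; have := v0 i; rewrite normr_eq0 => /eqP.
move=> i; have := vA i; rewrite !mxE -normrM => <-.
apply: le_trans (ler_norm_sum _ _ _) _; apply: ler_sum => j _.
by rewrite mxE normrM normr_nat mulrC symG.
Qed.

(** The vertices that are not neighbours of [i] are [i] itself, contributing its degree, and its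
    non-neighbours, contributing at least 1 each; together this is at least [n.-1]. *)
Lemma degree_sum_neighbours n (G : rel 'I_n) i :
  irreflexive G -> (forall j, 0 < degree G j)%N ->
  (\sum_(j | G i j) degree G j + n.-1 <= \sum_j degree G j)%N.
Proof.
move=> irrG d0; rewrite [X in (_ <= X)%N](bigID (G i)) /= leq_add2l.
rewrite (bigD1 i) ?irrG //= -(codegreeE i irrG) leq_add2l /codegree -sum1dep_card.
rewrite [X in (_ <= X)%N](eq_bigl (fun j => (j != i) && ~~ G i j)); last by move=> j; rewrite andbC.
by apply: leq_sum => j _.
Qed.

(** Hong's bound rho^2 <= 2e - n + 1. Applying the adjacency inequality twice at a maximal
    coordinate [i] bounds rho^2 by the sum of the degrees of the neighbours of [i]. *)
Lemma hong_bound n (G : rel 'I_n) r :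
  symmetric G -> irreflexive G -> (forall j, 0 < degree G j)%N ->
  spectral_radius (adjmx G) r -> r ^+ 2 + n.-1%:R <= (\sum_j degree G j)%:R.
Proof.
move=> symG irrG d0 [[l eigl <-] _].
have [y [y0 [i0 yi0] ly]] := abs_eigenvector symG eigl.
have [|i _ imax] := @real_arg_maxP _ _ i0 predT y isT; first by move=> i _; apply: ger0_real.
have yi : 0 < y i.
  by apply: lt_le_trans (imax i0 isT); rewrite lt_neqAle eq_sym yi0 y0.
have row j : \sum_k (G j k)%:R * y k <= (degree G j)%:R * y i.
  rewrite /degree -sum1dep_card natr_sum mulr_suml [X in _ <= X]big_mkcond /=.
  apply: ler_sum => k _; case: (G j k); rewrite ?mul1r ?mul0r //; exact: imax.
have : `|l| ^+ 2 * y i <= (\sum_(j | G i j) degree G j)%:R * y i.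
  rewrite expr2 -mulrA; apply: le_trans (ler_wpM2l (normr_ge0 l) (ly i)) _.
  rewrite mulr_sumr natr_sum mulr_suml [X in _ <= X]big_mkcond /=.
  apply: ler_sum => j _; case: (G i j); rewrite ?mul0r ?mulr0 // mul1r.
  exact: le_trans (ly j) (row j).
rewrite ler_pM2r // => le; apply: le_trans (lerD le (lexx _)) _.
by rewrite -natrD ler_nat degree_sum_neighbours.
Qed.

(** The Rayleigh quotient at the indicator vector of a clique with [c.+1] vertices is at least
    [c]. *)
Lemma spectral_radius_clique n (G : rel 'I_n) r (C : {set 'I_n}) c :
  symmetric G -> spectral_radius (adjmx G) r -> #|C| = c.+1 ->
  (forall x y, x \in C -> y \in C -> x != y -> G x y) -> c%:R <= r.
Proof.
move=> symG rG cC Cc; pose y i : algC := (i \in C)%:R.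
have [|le _] := @spectral_radius_sum n G r y symG rG; first by move=> i; apply: ler0n.
have yC : \sum_i y i ^+ 2 = c.+1%:R.
  rewrite -cC -sum1_card natr_sum [RHS]big_mkcond; apply: eq_bigr => i _.
  by rewrite /y; case: (i \in C); rewrite ?expr1n ?expr0n.
rewrite -(ler_pM2r (ltr0Sn _ c)) -yC; apply: le_trans le.
rewrite mulr_sumr; apply: ler_sum => i _; rewrite {1 2}/y.
have [iC|_] := boolP (i \in C); last by rewrite expr0n mulr0 mul0r.
rewrite expr1n mulr1 mul1r.
have -> : c = #|C :\ i| by have := cardsD1 i C; rewrite iC cC => -[].
rewrite -sum1_card natr_sum big_mkcond; apply: ler_sum => j _; rewrite /y !inE.
have [->|ji] := eqVneq j i; first by rewrite /= mulr_ge0 ?ler0n.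
by case: (boolP (j \in C)) => jC /=; rewrite ?mulr0 // Cc ?mulr1 // eq_sym.
Qed.

(* The equation of a positive Perron vector of [H] fails in some coordinate if an
   edge of [H] is missing from [G]. *)
Lemma spectral_radius_sub n (G H : rel 'I_n) (f : {perm 'I_n}) z0 rG rH :
  symmetric G -> symmetric H -> (forall z, z != z0 -> H z0 z) ->
  spectral_radius (adjmx G) rG -> spectral_radius (adjmx H) rH -> rH <= rG ->
  (forall x y, G x y -> H (f x) (f y)) -> forall x y, G x y = H (f x) (f y).
Proof.
move=> symG symH dom [[l eigl lG] _] sH rle GH.
have [y' [y0' [i1 yi1] ly']] := abs_eigenvector symG eigl; rewrite lG in ly'.
pose y i := y' ((f^-1)%g i); pose G' i j := G ((f^-1)%g i) ((f^-1)%g j).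
have y0 i : 0 <= y i by apply: y0'.
have G'H i j : G' i j -> H i j by move=> /GH; rewrite !permKV.
have ly i : rG * y i <= \sum_j (G' i j)%:R * y j.
  apply: le_trans (ly' _) _; rewrite (reindex_inj (@perm_inj _ (f^-1)%g)) //.
have GHle i : \sum_j (G' i j)%:R * y j <= \sum_j (H i j)%:R * y j.
  apply: ler_sum => j _; apply: ler_wpM2r => //; rewrite ler_nat.
  by case: (boolP (G' i j)) => // /G'H ->.
have rly i : rH * y i <= rG * y i by apply: ler_wpM2r.
(* The chain rH y <= rG y <= A(G') y <= A(H) y, entrywise, makes [y] attain the maximum of the
   Rayleigh quotient of [H]. *)
have [_ /(_ _) eqH] := spectral_radius_sum symH sH y0.
have {}eqH i : \sum_j (H i j)%:R * y j = rH * y i.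
  apply: eqH; rewrite mulr_sumr; apply: ler_sum => j _.
  rewrite expr2 mulrCA; apply: ler_wpM2l => //.
  exact: le_trans (rly j) (le_trans (ly j) (GHle j)).
have {}yi1 : y (f i1) != 0 by rewrite /y permK.
have term_le i j : (H i j)%:R * y j <= rH * y i.
  rewrite -eqH (bigD1 j) //= lerDl; apply: sumr_ge0 => k _.
  by rewrite mulr_ge0 ?ler0n.
have nz i j : H i j -> y j != 0 -> y i != 0.
  move=> Hij; apply: contra_neq => yi; apply/eqP; rewrite eq_le y0 andbT.
  by have := term_le i j; rewrite Hij yi mulr0 mul1r.
(* Positivity passes from [f i1] to the dominating vertex [z0], and from there to every vertex. *)
have yz0 : y z0 != 0.
  by have [E|/dom Hz] := eqVneq (f i1) z0; [rewrite -E|apply: nz Hz yi1].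
have yn0 i : y i != 0.
  have [->//|/dom Hz] := eqVneq i z0; apply: nz yz0; by rewrite symH.
have eqGH i j : G' i j = H i j.
  apply/idP/idP; first exact: G'H.
  move=> Hij; apply/negPn/negP=> nG.
  have : \sum_k (H i k)%:R * y k <= \sum_k (G' i k)%:R * y k.
    by rewrite eqH; apply: le_trans (rly i) (ly i).
  apply/negP; rewrite -real_ltNge ?ger0_real ?sumr_ge0 //; last first.
  - by move=> k _; rewrite mulr_ge0 ?ler0n.
  - by move=> k _; rewrite mulr_ge0 ?ler0n.
  rewrite (bigD1 j) // [X in _ < X](bigD1 j) //= (negbTE nG) Hij mul0r mul1r.
  apply: ltr_leD; first by rewrite lt_neqAle eq_sym yn0 y0.
  apply: ler_sum => k _; apply: ler_wpM2r => //; rewrite ler_nat.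
  by case: (boolP (G' i k)) => // /G'H ->.
by move=> x z; rewrite -eqGH /G' !permK.
Qed.

(** * The extremal graph and the final comparison *)

Lemma extremal_graph_sym n m k : symmetric (extremal_graph n m k).
Proof.
move=> i j; rewrite /extremal_graph eq_sym; congr (_ && _).
by rewrite orbCA [X in _ || (_ || X)]andbC.
Qed.

Lemma card_ord_lt n c : (c <= n)%N -> #|[set i : 'I_n | (i < c)%N]| = c.
Proof.
move=> cn; rewrite -sum1dep_card -(big_ord_widen n (fun=> 1%N)) //.
by rewrite sum1_card card_ord.
Qed.

Unset Implicit Arguments.

(** The second lower bound on [n] is doubled to clear its halves. *)
Theorem theorem1p11 (m k n : nat) (G : rel 'I_n) (rG rH : algC) :
  (1 <= m)%N -> (2 <= k)%N ->
  simple_graph G -> m_connected m G ->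
  ((7 * k - 2) * m + 4 <= n)%N ->
  (2 * (k - 1) * m ^ 2 + (3 * k + 1) * m + 9 <= 2 * n)%N ->
  spectral_radius (adjmx G) rG ->
  spectral_radius (adjmx (extremal_graph n m k)) rH ->
  rH <= rG ->
  has_spanning_k_tree k G \/ graph_iso G (extremal_graph n m k).
Proof.
move=> m1 k2 [symG irrG] conG n1 n2 sG sH rle.
have n0 : (0 < n)%N by apply: leq_trans n1; rewrite addnS.
have km : (m <= k * m)%N by rewrite leq_pmull // ltnW.
have k1m : ((k - 1) * m = k * m - m)%N by rewrite mulnBl mul1n.
have big : (k * m + 2 * m + 4 <= n)%N.
  apply: leq_trans n1; rewrite mulnBl -mulnA leq_add2r.
  by move: km; move: (k * m)%N => K; lia.
(* The [m] dominating vertices and the clique block together form a clique on n - (k-1)m - 1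
   vertices. *)
have rHge : (n - ((k - 1) * m + 2))%N%:R <= rH.
  have cE : (m + (n - k * m - 1) = (n - ((k - 1) * m + 2)).+1)%N.
    by rewrite k1m; move: big km; move: (k * m)%N => K; lia.
  pose C := [set i : 'I_n | (i < m + (n - k * m - 1))%N].
  apply: (spectral_radius_clique (C := C) (@extremal_graph_sym n m k) sH).
    by rewrite card_ord_lt cE // k1m; move: big; move: (k * m)%N => K; lia.
  by move=> x y; rewrite !inE => xC yC xy; rewrite /extremal_graph xy xC yC !orbT.
have degG j : (0 < degree G j)%N by apply: leq_trans m1 (min_degree j irrG conG).
(* [hong_bound] turns rho(G) >= rho(H) >= n - (k-1)m - 2 into a lower bound on the degree sum. *)
have sumG : ((n - ((k - 1) * m + 2)) ^ 2 + n.-1 <= \sum_j degree G j)%N.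
  rewrite -(ler_nat algC) natrD natrX.
  apply: le_trans (hong_bound symG irrG degG sG); rewrite lerD2r.
  by rewrite lerXn2r ?nnegrE ?ler0n ?(le_trans _ rle) ?(le_trans _ rHge) ?ler0n.
have [con|[f Hf]] := dense_conn_bounded m1 k2 symG irrG conG n1 n2 sumG.
  by left; apply: conn_bounded_spanning_k_tree.
right; exists f.
have dom z : z != Ordinal n0 -> extremal_graph n m k (Ordinal n0) z.
  by move=> z0; rewrite /extremal_graph eq_sym z0 /= m1.
exact: spectral_radius_sub (@extremal_graph_sym n m k) dom sG sH rle Hf.
Qed.
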